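(* Assume that: (C1) $A(s)$ is compact for every $s\in S$ and the correspondence $s\mapsto A(s)$ is continuous; (C2) $u$ is continuous on $\mathbb K$; (C3) $q$ is Feller, i.e. $(s,a)\mapsto\int_S v(s')q(ds'|s,a)$ is continuous on $\mathbb K$ for each bounded continuous $v:S\to\mathbb R$. Consider the Bellman equation $$v(s)=\sup_{a\in A(s)}\left((1-\beta)u(s,a)^p+\beta\left[\frac1r\ln\int_S e^{rv(s')}q(ds'|s,a)\right]^p\right)^{1/p}\quad\text{for all } s\in S.$$ Then: (a) the Bellman equation has a solution $v^*\in\widehat{\mathcal C}$; (b) $v^*$ is the unique solution to the Bellman equation in the class $\widehat{\mathcal A}$.
   Context: Model. $S$ (states) and $A$ (actions) are Borel spaces, i.e. non-empty Borel subsets of complete separable metric spaces. $\mathbb K\subset S\times A$ is a non-empty Borel set such that each section $A(s)=\{a\in A:(s,a)\in\mathbb K\}$, $s\in S$, is non-empty. $q$ is a Borel measurable transition probability from $\mathbb K$ to $S$. $u:\mathbb K\to\mathbb R$ is Borel measurable with $b_0\le u(s,a)\le b_1$ for all $(s,a)\in\mathbb K$, where $b_1>b_0>0$ are constants. $\beta\in[0,1)$, $r<0$, and $p<1$, $p\ne0$ are fixed real parameters. Constants. $0<\epsilon<B$ are fixed constants chosen as follows: if $p<0$, then $\epsilon\le b_0$ and $B\ge(1-\beta)^{1/p}b_1$; if $p\in(0,1)$, then $\epsilon\le(1-\beta)^{1/p}b_0$ and $B\ge b_1$. Function classes. A subset of a Borel space $Y$ is analytic if it is the projection onto $Y$ of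 a Borel subset of $Y\times Y$. A function $g:Y\to\mathbb R$ is upper semianalytic if $\{y:g(y)>c\}$ is analytic for every $c\in\mathbb R$ (such functions are universally measurable; integrals are taken with respect to completed measures). $\widehat{\mathcal A}$ is the set of all upper semianalytic functions $v:S\to[\epsilon,B]$; $\widehat{\mathcal C}$ is the set of all continuous functions $v:S\to[\epsilon,B]$. A correspondence $\varphi$ from $S$ to a separable metric space $Z$ is upper (lower) semicontinuous if $\{s\in S:\varphi(s)\cap D\ne\emptyset\}$ is closed (open) for each closed (open) $D\subset Z$, and continuous if it is both upper and lower semicontinuous. *)

(* Defs.v *)
(* MathComp-Analysis *)
From HB Require Import structures.
From mathcomp Require Import all_boot all_order all_algebra.
From mathcomp Require Import all_classical all_reals all_analysis.
From mathcomp Require Import measurable_realfun.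

Set Implicit Arguments.
Unset Strict Implicit.
Unset Printing Implicit Defensive.

Import Order.TTheory GRing.Theory Num.Theory.
Import numFieldNormedType.Exports.

Local Open Scope classical_set_scope.
Local Open Scope ring_scope.

#[short(type="completeMetricType")]
HB.structure Definition CompleteMetric (R : realType) :=
  { T of Complete T & Metric R T }.

Definition separable_space (T : topologicalType) : Prop :=
  exists2 D : set T, countable D & dense D.

Definition borel_set (T : topologicalType) (E : set T) : Prop := <<s open >> E.

Notation borelType T := (g_sigma_algebraType (@open T)).

Record borelSpace (R : realType) := BorelSpace {
  ambient : completeMetricType R ;
  carrier : set ambient ;
  ambient_separable : separable_space ambient ;
  carrier_borel : borel_set carrier ;
  carrier_nonempty : carrier !=set0 }.

Definition borel_sort (R : realType) (S : borelSpace R) : Type :=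
  set_type (@carrier R S).
Coercion borel_sort : borelSpace >-> Sortclass.

Section borel_sort_instances.
Context (R : realType) (S : borelSpace R).

HB.instance Definition _ := PseudoMetric.copy (borel_sort S)
  (set_type (@carrier R S)).

(* Measurable types are pointed in the library; the point is arbitrary. *)
Definition borel_point : borel_sort S :=
  let: exist x Sx := cid (@carrier_nonempty R S) in exist _ x (mem_set Sx).

HB.instance Definition _ := isPointed.Build (borel_sort S) borel_point.

End borel_sort_instances.

Definition analytic_set (T : topologicalType) (E : set T) : Prop :=
  exists2 D : set (T * T), borel_set D & E = fst @` D.

Definition upper_semianalytic (R : realType) (T : topologicalType)
  (g : T -> R) : Prop := forall c : R, analytic_set [set y | c < g y].

Definition class_A (R : realType) (S : borelSpace R) (eps B : R)
    : set (S -> R) :=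
  [set v | upper_semianalytic v /\ forall s, eps <= v s <= B].

Definition class_C (R : realType) (S : borelSpace R) (eps B : R)
    : set (S -> R) :=
  [set v | continuous v /\ forall s, eps <= v s <= B].

Definition upper_semicontinuous_corr (X Z : topologicalType)
  (phi : X -> set Z) : Prop :=
  forall D : set Z, closed D -> closed [set s | phi s `&` D !=set0].

Definition lower_semicontinuous_corr (X Z : topologicalType)
  (phi : X -> set Z) : Prop :=
  forall D : set Z, open D -> open [set s | phi s `&` D !=set0].

Definition continuous_corr (X Z : topologicalType) (phi : X -> set Z) : Prop :=
  upper_semicontinuous_corr phi /\ lower_semicontinuous_corr phi.

Section model.
Context (R : realType) (S A : borelSpace R).

(* The functions u and q live on the set K; they are represented by total
   functions on S * A, whose values off K are never used. *)
Definition actions (K : set (S * A)) (s : S) : set A := [set a | K (s, a)].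

Definition transition_probability (K : set (S * A))
    (q : S * A -> probability (borelType S) R) : Prop :=
  forall E : set (borelType S), measurable E ->
    measurable_fun (K : set (borelType (S * A)%type)) (q ^~ E).

Definition feller (K : set (S * A))
    (q : S * A -> probability (borelType S) R) : Prop :=
  forall v : S -> R, continuous v -> (exists M, forall s, `|v s| <= M) ->
    {within K, continuous (fun k => \int[q k]_x v x)}.

(* Value functions are only universally measurable, so the integral is taken
   against the completion of q k. For a finite measure, the Caratheodory
   extension of the measure is its completion. *)
Definition certainty_equivalent (r : R)
    (q : S * A -> probability (borelType S) R) (v : S -> R) (k : S * A) : R :=
  r^-1 * ln (\int[@completed_measure_extension _ _ _ (q k)]_x expR (r * v x)).

(* For v in class_A the set under the supremum is non-empty and bounded, so
   that the real-valued sup is the true supremum. *)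
Definition bellman_equation (K : set (S * A)) (u : S * A -> R)
    (q : S * A -> probability (borelType S) R) (beta r p : R)
    (v : S -> R) : Prop :=
  forall s : S, v s =
    sup [set ((1 - beta) * u (s, a) `^ p
              + beta * certainty_equivalent r q v (s, a) `^ p) `^ p^-1
        | a in actions K s].

End model.

(* Main.v *)
(* The entropic certainty equivalent CE is monotone and, because [r < 0],
   subhomogeneous: [v <= l w] with [l >= 1] gives [CE v <= l CE w]. The CES
   aggregator has elasticity at most some [k < 1] in its second argument on the
   relevant box, so the Bellman operator [T] is a [k]-contraction in the metric
   [sup |ln v - ln w|]: [v <= e^l w] implies [T v <= e^(k l) T w]. The iterates
   [T^n eps] therefore increase to a fixed point, uniformly, and by Berge's
   theorem they are continuous. The library's integral of a nonnegative function
   is a supremum over simple functions, i.e. a lower integral, for which the two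
   properties of CE hold without measurability; hence uniqueness needs no theory
   of analytic sets. *)
Require Import Defs.
From HB Require Import structures.
From mathcomp Require Import all_boot all_order all_algebra.
From mathcomp Require Import all_classical all_reals all_analysis.
From mathcomp Require Import measurable_realfun.
From mathcomp Require Import ring lra.

Set Implicit Arguments.
Unset Strict Implicit.
Unset Printing Implicit Defensive.

Import Order.TTheory GRing.Theory Num.Theory.
Import numFieldNormedType.Exports.

Local Open Scope classical_set_scope.
Local Open Scope ring_scope.

(** * Exponential inequalities from convexity *)

Lemma expR_convex1 (R : realType) (t x : R) : 0 <= t <= 1 ->
  expR (t * x) <= 1 - t + t * expR x.
Proof.
move=> t01.
have := @convex_expR R (Itv01 (proj1 (andP t01)) (proj2 (andP t01))) x 0.
by rewrite !convRE/= expR0 mulr0 addr0 mulr1 /unstable.onem addrC.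
Qed.

(** Bernoulli's inequality [y ^ l >= 1 + l (y - 1)] at [y = expR x]. It is convexity with weight
    [l^-1] at the point [l * x], multiplied by [l]. *)
Lemma expR_bernoulli (R : realType) (l x : R) : 1 <= l ->
  1 + l * (expR x - 1) <= expR (l * x).
Proof.
move=> l1; have l0 : 0 < l by exact: lt_le_trans l1.
have : expR (l^-1 * (l * x)) <= 1 - l^-1 + l^-1 * expR (l * x).
  by apply: expR_convex1; rewrite invr_ge0 ltW//= invf_le1.
rewrite mulKf ?gt_eqF// => /(ler_wpM2l (ltW l0)).
rewrite mulrDr mulrBr mulr1 mulfV ?gt_eqF// mulVKf ?gt_eqF//.
by rewrite mulrBr mulr1; lra.
Qed.

(** * Lower integrals and the entropic certainty equivalent *)

Section lower_integral.
Context d (T : measurableType d) (R : realType).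
Variable mu : {measure set T -> \bar R}.
Import HBNNSimple.

(** Every simple function below [f] lies below [g], so the supremum that defines the integral of [g]
    runs over a larger set. *)
Lemma ge0_le_integralT (f g : T -> \bar R) : (forall x, 0 <= f x)%E ->
  (forall x, f x <= g x)%E -> (\int[mu]_x f x <= \int[mu]_x g x)%E.
Proof.
move=> f0 fg; rewrite !ge0_integralTE//; last first.
  by move=> x; exact: le_trans (fg x).
apply: le_ereal_sup => _ [h /= hf <-]; exists h => //= x.
exact: le_trans (fg x).
Qed.

Hypothesis mu1 : mu setT = 1%E.

Lemma integral_bounded (f : T -> R) (m M : R) : 0 <= m ->
  (forall x, m <= f x <= M) ->
  (m%:E <= \int[mu]_x (f x)%:E <= M%:E)%E.
Proof.
move=> m0 fmM.
have fm x : m <= f x by case/andP: (fmM x).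
have fM x : f x <= M by case/andP: (fmM x).
have ic (c : R) : (\int[mu]_x c%:E)%E = c%:E.
  by rewrite integral_cst// mu1 mule1.
rewrite -{1}(ic m) -(ic M); apply/andP; split; apply: ge0_le_integralT => x;
  rewrite lee_fin//.
exact: le_trans (fm x).
Qed.

Lemma Rintegral_bounded (f : T -> R) (m M : R) : 0 <= m ->
  (forall x, m <= f x <= M) -> m <= \int[mu]_x f x <= M.
Proof.
move=> m0 /(integral_bounded m0) /andP[Hm HM].
rewrite /Rintegral -!lee_fin fineK ?Hm ?HM// ge0_fin_numE.
  exact: le_lt_trans HM (ltry _).
by rewrite (le_trans _ Hm)// lee_fin.
Qed.

(* [f] and [g] are arbitrary functions: the integrals are lower integrals. *)
Lemma le_affine_Rintegral (f g : T -> R) (a b M : R) : 0 < a -> 0 <= b ->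
  (forall x, 0 <= f x <= M) -> (forall x, 0 <= g x <= M) ->
  (forall x, a * f x - b <= g x) ->
  a * \int[mu]_x f x - b <= \int[mu]_x g x.
Proof.
move=> a0 b0 fM gM fg.
have iM h : (forall x, 0 <= h x <= M) -> (\int[mu]_x (h x)%:E)%E \is a fin_num.
  move=> /(integral_bounded (lexx 0)) /andP[H0 HM].
  by rewrite ge0_fin_numE//; exact: le_lt_trans HM (ltry _).
rewrite lerBlDr -ler_pdivlMl// /Rintegral -lee_fin fineK ?iM//.
rewrite ge0_integralTE; last by move=> x; rewrite lee_fin; case/andP: (fM x).
apply: ge_ereal_sup => _ [h /= hf <-].
rewrite -integralT_nnsfun EFinM EFinD fineK ?iM//.
rewrite lee_pdivlMl// -ge0_integralZl//; last 3 first.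
- by apply/measurable_EFinP; exact: measurable_funP.
- by move=> x _; rewrite lee_fin.
- by rewrite lee_fin ltW.
(* The positive part keeps the candidate nonnegative. It is still below [g] because [g >= 0], it
   satisfies [a * h <= h' + b], and it is measurable, so that additivity of the integral applies to
   [h' + b]. *)
pose h' x := Num.max (a * h x - b) 0.
have mh' : measurable_fun setT h'.
  apply: measurable_maxr => //; apply: measurable_funB => //.
  by apply: measurable_funM => //; exact: measurable_funP.
apply: (@le_trans _ _ (\int[mu]_x ((h' x)%:E + b%:E))%E).
  apply: ge0_le_integralT => x.
    by rewrite -EFinM lee_fin mulr_ge0// ltW.
  by rewrite -EFinM -EFinD lee_fin -lerBlDr le_max lexx.
rewrite ge0_integralD//; last 2 first.
- by move=> x _; rewrite lee_fin le_max lexx orbT.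
- exact/measurable_EFinP.
rewrite integral_cst// mu1 mule1 leeD2r//; apply: ge0_le_integralT => x.
  by rewrite lee_fin le_max lexx orbT.
have /andP[g0 _] := gM x; rewrite lee_fin ge_max g0 andbT.
apply: le_trans (fg x); rewrite lerB// ler_pM2l//.
by have := hf x; rewrite lee_fin.
Qed.

Section entropic.
Variables (r eps B : R).
Hypothesis r0 : r < 0.

Let expR_box (v : T -> R) : (forall x, eps <= v x <= B) ->
  forall x, expR (r * B) <= expR (r * v x) <= expR (r * eps).
Proof.
move=> bv x; have /andP[? ?] := bv x.
by rewrite !ler_expR !ler_nM2l// andbC; apply/andP.
Qed.

Lemma Rintegral_expR_bounded (v : T -> R) : (forall x, eps <= v x <= B) ->
  expR (r * B) <= \int[mu]_x expR (r * v x) <= expR (r * eps).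
Proof. by move=> /expR_box; apply: Rintegral_bounded; exact: expR_ge0. Qed.

Lemma Rintegral_expR_gt0 (v : T -> R) : (forall x, eps <= v x <= B) ->
  0 < \int[mu]_x expR (r * v x).
Proof.
by move=> /Rintegral_expR_bounded/andP[+ _]; apply: lt_le_trans;
  exact: expR_gt0.
Qed.

Lemma entropic_bounded (v : T -> R) : (forall x, eps <= v x <= B) ->
  eps <= r^-1 * ln (\int[mu]_x expR (r * v x)) <= B.
Proof.
move=> bv; have /andP[Hm HM] := Rintegral_expR_bounded bv.
have I0 := Rintegral_expR_gt0 bv.
rewrite ler_ndivlMl// ler_ndivrMl// -ler_expR lnK ?posrE// HM/=.
by rewrite -ler_expR lnK ?posrE// Hm.
Qed.

(* Jensen's inequality [E (X ^ l) >= (E X) ^ l] for [X = exp (r w)]: the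
   entropic certainty equivalent is subhomogeneous because [r < 0]. *)
Lemma entropic_subhomogeneous (v w : T -> R) (l : R) :
  (forall x, eps <= v x <= B) -> (forall x, eps <= w x <= B) -> 1 <= l ->
  (forall x, v x <= l * w x) ->
  r^-1 * ln (\int[mu]_x expR (r * v x)) <=
  l * (r^-1 * ln (\int[mu]_x expR (r * w x))).
Proof.
move=> bv bw l1 vw.
have Iv := Rintegral_expR_gt0 bv; have Iw := Rintegral_expR_gt0 bw.
set M := ln (\int[mu]_x expR (r * w x)).
rewrite mulrCA ler_nM2l ?invr_lt0// -ler_expR lnK ?posrE//.
(* The affine minorant is the tangent to [t ^ l] at [t = expR M], the mean of [expR (r * w)]: its
   slope is [l * expR ((l - 1) * M)], its intercept [- (l - 1) * expR (l * M)]. Its value at the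
   mean is [expR (l * M)], the bound wanted. *)
have := @le_affine_Rintegral (fun x => expR (r * w x)) (fun x => expR (r * v x))
  (l * expR ((l - 1) * M)) ((l - 1) * expR (l * M)) (expR (r * eps)).
rewrite -{1}[X in _ * X - _](@lnK _ (Rintegral _ _ _)) ?posrE// -/M.
have eM : expR ((l - 1) * M) * expR M = expR (l * M).
  by rewrite -expRD; congr expR; ring.
rewrite -mulrA eM -mulrBl subKr mul1r; apply.
- by rewrite mulr_gt0 ?expR_gt0// (lt_le_trans _ l1).
- by rewrite mulr_ge0 ?expR_ge0// subr_ge0.
- by move=> x; have /andP[_ ->] := expR_box bw x; rewrite expR_ge0.
- by move=> x; have /andP[_ ->] := expR_box bv x; rewrite expR_ge0.
- move=> x; apply: (@le_trans _ _ (expR (r * (l * w x)))); last first.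
    by rewrite ler_expR ler_nM2l.
  have := expR_bernoulli (r * w x - M) l1.
  rewrite -(ler_pM2r (expR_gt0 (l * M))) -expRD.
  have -> : l * (r * w x - M) + l * M = r * (l * w x) by ring.
  apply: le_trans; rewrite expRB -eM le_eqVlt; apply/orP; left; apply/eqP.
  by field; rewrite gt_eqF ?expR_gt0.
Qed.

End entropic.
End lower_integral.

(** * Completion of a probability measure *)

Lemma Rintegral_completed d (T : measurableType d) (R : realType)
    (mu : probability T R) (f : T -> R) : measurable_fun setT f ->
  (forall x, 0 <= f x) ->
  \int[@completed_measure_extension _ _ _ mu]_x f x = \int[mu]_x f x.
Proof.
move=> mf f0; rewrite /Rintegral; congr fine.
(* The Caratheodory sigma-algebra contains the original one, so the identity is measurable, and the
   pushforward of the completion along it agrees with [mu] on measurable sets. *)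
have mid : measurable_fun setT
    (idfun : caratheodory_type (mu^*)%mu -> T).
  by move=> _ E mE; rewrite setTI; exact: caratheodory_measurable_mu_ext.
have := @ge0_integral_pushforward _ _ (caratheodory_type (mu^*)%mu) T R idfun
  mid (@completed_measure_extension _ _ _ mu) setT (EFin \o f) measurableT.
rewrite preimage_setT => <-; last 2 first.
- exact/measurable_EFinP.
- by move=> x _; rewrite lee_fin.
apply: eq_measure_integral => E mE _.
transitivity ((mu^*)%mu E) => //; exact: measurable_mu_extE.
Qed.

Lemma completed_setT d (T : measurableType d) (R : realType)
    (mu : probability T R) :
  @completed_measure_extension _ _ _ mu setT = 1%E.
Proof.
by rewrite /completed_measure_extension measurable_mu_extE//= probability_setT.
Qed.

(** * Powers and the CES aggregator *)

Lemma le0_ger_powR (R : realType) (p x y : R) : p <= 0 -> 0 < x -> x <= y ->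
  y `^ p <= x `^ p.
Proof.
move=> p0 x0 xy; have y0 : 0 < y by exact: lt_le_trans xy.
rewrite -[p]opprK !(powRN _ (- p)) lef_pV2 ?posrE ?powR_gt0//.
by rewrite ge0_ler_powR ?nnegrE ?oppr_ge0// ltW.
Qed.

Lemma powR_inv_exponent (R : realType) (p x : R) : p != 0 -> 0 <= x ->
  (x `^ p) `^ p^-1 = x.
Proof. by move=> p0 x0; rewrite -powRrM mulfV// powRr1. Qed.

(** The constant-elasticity-of-substitution aggregator of the current utility [x] and the certainty
    equivalent [y] of the future. *)
Definition ces (R : realType) (beta p x y : R) : R :=
  ((1 - beta) * x `^ p + beta * y `^ p) `^ p^-1.

Section ces.
Context (R : realType) (beta p : R).
Hypotheses (beta01 : 0 <= beta < 1) (p0 : p != 0).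

Let beta_ge0 : 0 <= beta. Proof. by case/andP: beta01. Qed.
Let beta_lt1 : 0 < 1 - beta. Proof. by case/andP: beta01; rewrite subr_gt0. Qed.

Lemma ces_arg_gt0 (x y : R) : 0 < x ->
  0 < (1 - beta) * x `^ p + beta * y `^ p.
Proof.
by move=> x0; rewrite ltr_wpDr ?mulr_gt0 ?powR_gt0// mulr_ge0 ?powR_ge0.
Qed.

(** One bound comes from discarding [beta * y ^ p], which leaves [(1 - beta) ^ (1/p) * x]: an upper
    bound if [p < 0], a lower bound if [p > 0]. The other holds because a power mean of two numbers
    on one side of [eps] or [B] stays on that side. *)
Lemma ces_bounded (b0 b1 eps B x y : R) : 0 < b0 -> 0 < eps ->
  (p < 0 -> eps <= b0 /\ (1 - beta) `^ p^-1 * b1 <= B) ->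
  (0 < p -> eps <= (1 - beta) `^ p^-1 * b0 /\ b1 <= B) ->
  b0 <= x <= b1 -> eps <= y <= B -> eps <= ces beta p x y <= B.
Proof.
move=> b00 eps0 hneg hpos /andP[b0x xb1] /andP[epsy yB].
have x0 : 0 < x := lt_le_trans b00 b0x.
have y0 : 0 < y := lt_le_trans eps0 epsy.
have B0 : 0 < B := lt_le_trans y0 yB.
have scaled : (1 - beta) `^ p^-1 * x = ((1 - beta) * x `^ p) `^ p^-1.
  by rewrite powRM ?powR_ge0 ?(ltW beta_lt1)// powR_inv_exponent// ltW.
have arg_ge : (1 - beta) * x `^ p <= (1 - beta) * x `^ p + beta * y `^ p.
  by rewrite lerDl mulr_ge0 ?powR_ge0.
have mix (c : R) : c = (1 - beta) * c + beta * c by ring.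
have s0 : 0 < (1 - beta) `^ p^-1 by rewrite powR_gt0.
rewrite /ces.
have [pneg|ppos|pE] := ltgtP p 0; last by move: p0; rewrite pE eqxx.
- have [epsb0 bB] := hneg pneg; have ip0 : p^-1 <= 0 by rewrite invr_le0 ltW.
  apply/andP; split.
    rewrite -[X in X <= _](powR_inv_exponent p0 (ltW eps0)).
    apply: le0_ger_powR => //; first exact: ces_arg_gt0.
    rewrite [leRHS]mix lerD// ler_wpM2l// ?(ltW beta_lt1)//.
      by apply: le0_ger_powR => //; [exact: ltW|exact: le_trans b0x].
    by apply: le0_ger_powR => //; exact: ltW.
  apply: le_trans bB.
  apply: (@le_trans _ _ ((1 - beta) `^ p^-1 * x)); last first.
    by rewrite ler_pM2l.
  rewrite scaled; apply: le0_ger_powR => //.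
  by rewrite mulr_gt0// powR_gt0.
- have [epsb0 bB] := hpos ppos; have ip0 : 0 <= p^-1 by rewrite invr_ge0 ltW.
  apply/andP; split.
    apply: le_trans epsb0 _; apply: (@le_trans _ _ ((1 - beta) `^ p^-1 * x)).
      by rewrite ler_pM2l.
    rewrite scaled; apply: ge0_ler_powR; rewrite ?nnegrE//.
      by rewrite mulr_ge0 ?powR_ge0// ltW.
    exact/ltW/ces_arg_gt0.
  rewrite -[X in _ <= X](powR_inv_exponent p0 (ltW B0)).
  apply: ge0_ler_powR; rewrite ?nnegrE ?powR_ge0//; first exact/ltW/ces_arg_gt0.
  rewrite [leRHS]mix lerD// ler_wpM2l// ?(ltW beta_lt1)//.
    apply: ge0_ler_powR; rewrite ?nnegrE ?(ltW x0) ?(ltW B0) ?(ltW ppos)//.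
    exact: le_trans bB.
  by apply: ge0_ler_powR; rewrite ?nnegrE ?(ltW y0) ?(ltW B0) ?(ltW ppos).
Qed.

(** The last premise says that the share of [a] in [c + a] is at most [k]; scaling [a] by
    [expR (- x)] then costs the sum at most the factor [expR (- (k * x))]. Convexity replaces this
    factor by [1 - k + k * expR (- x)], and the rest is algebra. *)
Let shrink (k c a x : R) : 0 <= k <= 1 -> 0 <= c -> 0 <= a -> 0 <= x ->
  a <= k * (c + a) -> (c + a) * expR (- (k * x)) <= c + a * expR (- x).
Proof.
move=> k01 c0 a0 x0 ak.
have /(ler_wpM2l (addr_ge0 c0 a0)) := expR_convex1 (- x) k01.
rewrite mulrN => /le_trans; apply.
have e1 : expR (- x) <= 1 by rewrite -expR0 ler_expR oppr_le0.
nra.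
Qed.

(** The share of [y] increases in [y] and decreases in [x], hence is largest at the corner
    [(X, Y)]. *)
Let le_share (X Y x y : R) : 0 < X -> X <= x -> 0 <= y -> y <= Y ->
  beta * y <=
  beta * Y / ((1 - beta) * X + beta * Y) * ((1 - beta) * x + beta * y).
Proof.
move=> X0 Xx y0 yY.
have D0 : 0 < (1 - beta) * X + beta * Y.
  by rewrite ltr_wpDr ?mulr_gt0// mulr_ge0// (le_trans y0).
rewrite mulrAC ler_pdivlMr// -!mulrA ler_wpM2l//.
have : (1 - beta) * (y * X) <= (1 - beta) * (Y * x).
  by rewrite ler_pM2l// ler_pM// ltW.
lra.
Qed.

(* The elasticity of [ces] in its second argument,
   [beta y^p / ((1 - beta) x^p + beta y^p)], is bounded away from 1. *)
Lemma ces_log_contraction (b0 b1 eps B : R) : 0 < b0 -> 0 < eps ->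
  exists k : R, 0 <= k < 1 /\ forall l x y y' : R, 0 <= l -> b0 <= x <= b1 ->
    eps <= y <= B -> eps <= y' <= B -> y <= expR l * y' ->
    ces beta p x y <= expR (k * l) * ces beta p x y'.
Proof.
move=> b00 eps0.
have expRp (z w : R) : 0 <= w -> (expR z * w) `^ p = w `^ p * expR (p * z).
  by move=> w0; rewrite powRM ?expR_ge0// -expRM mulrC (mulrC z).
have factor (k l z : R) : 0 < z ->
    (z * expR (p * (k * l))) `^ p^-1 = expR (k * l) * z `^ p^-1.
  move=> z0; rewrite powRM ?expR_ge0 ?(ltW z0)// -expRM mulrC.
  congr (expR _ * _).
  by rewrite mulrAC mulfV// mul1r.
have share_lt1 X Y : 0 < X -> 0 <= Y ->
    0 <= beta * Y / ((1 - beta) * X + beta * Y) < 1.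
  move=> X0 Y0; have D0 : 0 < (1 - beta) * X + beta * Y.
    by rewrite ltr_wpDr ?mulr_gt0// mulr_ge0.
  by rewrite divr_ge0 ?mulr_ge0 ?(ltW D0)// ltr_pdivrMr// mul1r ltrDr mulr_gt0.
(* If [b1 <= 0], no [x] lies in [[b0, b1]] and any modulus will do. *)
have [b10|b10] := ltP 0 b1; last first.
  exists 0; rewrite lexx ltr01; split => // l x y y' _ /andP[b0x xb1].
  by have := lt_le_trans b00 (le_trans b0x (le_trans xb1 b10)); rewrite ltxx.
have [pneg|ppos|pE] := ltgtP p 0; last by move: p0; rewrite pE eqxx.
(* For [p < 0] powers reverse order, so the share is largest at [x = b1], [y = eps]. *)
- set k := beta * eps `^ p / ((1 - beta) * b1 `^ p + beta * eps `^ p).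
  have k01 : 0 <= k < 1 by apply: share_lt1; rewrite ?powR_gt0 ?powR_ge0.
  exists k; split => // l x y y' l0 /andP[b0x xb1] /andP[ey yB] /andP[ey' y'B]
    yy'.
  have [x0 y0 y'0] : [/\ 0 < x, 0 < y & 0 < y'].
    split; first exact: lt_le_trans b0x.
      exact: lt_le_trans ey.
    exact: lt_le_trans ey'.
  rewrite /ces -factor ?ces_arg_gt0//; apply: le0_ger_powR.
  - by rewrite invr_le0 ltW.
  - by rewrite mulr_gt0 ?expR_gt0 ?ces_arg_gt0.
  (* Here [- p * l >= 0], and [shrink] is applied to the share of [y']. *)
  have -> : p * (k * l) = - (k * (- p * l)) by ring.
  apply: (@le_trans _ _
    ((1 - beta) * x `^ p + beta * y' `^ p * expR (- (- p * l)))).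
    apply: shrink.
    - by case/andP: k01 => -> /ltW ->.
    - by rewrite mulr_ge0 ?powR_ge0// ltW.
    - by rewrite mulr_ge0 ?powR_ge0.
    - by rewrite mulr_ge0// oppr_ge0 ltW.
    - apply: le_share; rewrite ?powR_gt0 ?powR_ge0//.
        by apply: le0_ger_powR => //; exact: ltW.
      by apply: le0_ger_powR => //; exact: ltW.
  rewrite lerD2l -mulrA ler_wpM2l// mulNr opprK -expRp ?(ltW y'0)//.
  by apply: le0_ger_powR => //; exact: ltW.
(* For [p > 0] the share is largest at [x = b0], [y = B]. *)
- set k := beta * B `^ p / ((1 - beta) * b0 `^ p + beta * B `^ p).
  have k01 : 0 <= k < 1 by apply: share_lt1; rewrite ?powR_gt0 ?powR_ge0.
  exists k; split => // l x y y' l0 /andP[b0x xb1] /andP[ey yB] /andP[ey' y'B]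
    yy'.
  have [x0 y0 y'0] : [/\ 0 < x, 0 < y & 0 < y'].
    split; first exact: lt_le_trans b0x.
      exact: lt_le_trans ey.
    exact: lt_le_trans ey'.
  rewrite /ces -factor ?ces_arg_gt0//; apply: ge0_ler_powR.
  - by rewrite invr_ge0 ltW.
  - by rewrite nnegrE ltW// ces_arg_gt0.
  - by rewrite nnegrE mulr_ge0 ?expR_ge0 ?(ltW (ces_arg_gt0 _ _))//.
  (* The factor moves to the left to make its exponent nonpositive; [shrink] now applies to the
     share of [y] instead of [y']. *)
  rewrite -ler_pdivrMr ?expR_gt0// -expRN.
  have -> : - (p * (k * l)) = - (k * (p * l)) by ring.
  apply: (@le_trans _ _
    ((1 - beta) * x `^ p + beta * y `^ p * expR (- (p * l)))).
    apply: shrink.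
    - by case/andP: k01 => -> /ltW ->.
    - by rewrite mulr_ge0 ?powR_ge0// ltW.
    - by rewrite mulr_ge0 ?powR_ge0.
    - by rewrite mulr_ge0// ltW.
    - apply: le_share; rewrite ?powR_gt0 ?powR_ge0//.
        by apply: ge0_ler_powR;
          rewrite ?nnegrE ?(ltW ppos) ?(ltW b00) ?(ltW x0).
      apply: ge0_ler_powR; rewrite ?nnegrE ?(ltW ppos) ?(ltW y0)//.
      exact: le_trans (ltW y0) yB.
  rewrite lerD2l -mulrA ler_wpM2l// -mulrN -expRp ?(ltW y0)//.
  apply: ge0_ler_powR;
    rewrite ?nnegrE ?mulr_ge0 ?expR_ge0 ?(ltW y0) ?(ltW y'0) ?(ltW ppos)//.
  by rewrite expRN mulrC ler_pdivrMr ?expR_gt0// mulrC.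
Qed.

End ces.

(** * Continuity of powers and of the aggregator *)

Lemma powR_continuous (R : realType) (p x : R) : 0 < x ->
  {for x, continuous (fun z : R => z `^ p)}.
Proof.
move=> x0; apply/differentiable_continuous/derivable1_diffP.
by apply: derivable_powR; rewrite in_itv/= x0.
Qed.

Lemma cvg_ces (R : realType) (beta p : R) (T : Type) (F : set_system T)
    (FF : Filter F) (f g : T -> R) (x y : R) :
  0 <= beta < 1 -> 0 < x -> 0 < y -> f @ F --> x -> g @ F --> y ->
  (fun t => ces beta p (f t) (g t)) @ F --> ces beta p x y.
Proof.
move=> beta01 x0 y0 fx gy; rewrite /ces.
apply: (cvg_comp _ (fun z : R => z `^ p^-1)); last first.
  exact/powR_continuous/ces_arg_gt0.
have cvgp (h : T -> R) (z : R) : 0 < z -> h @ F --> z ->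
    (fun t => h t `^ p) @ F --> z `^ p.
  move=> z0 hz; apply: (cvg_comp _ (fun z : R => z `^ p)); first exact: hz.
  exact: powR_continuous.
by apply: cvgD; apply: cvgM;
  [exact: cvg_cst|exact: cvgp|exact: cvg_cst|exact: cvgp].
Qed.

(** * Fixed points of contractions in the logarithmic sup metric *)

Section thompson.
Context (R : realType) (X : topologicalType).
Variables (T : (X -> R) -> X -> R) (eps B k : R).
Hypotheses (eps0 : 0 < eps) (epsB : eps < B) (k01 : 0 <= k < 1).

Let box (v : X -> R) := forall x, eps <= v x <= B.

Hypothesis T_box : forall v, box v -> box (T v).
Hypothesis T_cont : forall v, box v -> continuous v -> continuous (T v).
Hypothesis T_contr : forall v w (l : R), box v -> box w -> 0 <= l ->
  (forall x, v x <= expR l * w x) -> forall x, T v x <= expR (k * l) * T w x.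

Let v_ n := iter n T (fun=> eps).
(** The logarithmic diameter of the box: [B = expR L * eps]. *)
Let L := ln (B / eps).

Let L_ge0 : 0 <= L.
Proof. by rewrite ln_ge0// ler_pdivlMr// mul1r ltW. Qed.

Let v_box n : box (v_ n).
Proof. by elim: n => [x|n ih] /=; [rewrite lexx ltW|exact: T_box]. Qed.

(** The case [l = 0] of [T_contr]. *)
Let T_mono v w : box v -> box w -> (forall x, v x <= w x) ->
  forall x, T v x <= T w x.
Proof.
move=> bv bw vw x; have := T_contr bv bw (lexx 0) _ x.
by rewrite mulr0 expR0 mul1r; apply => y; rewrite mul1r.
Qed.

Let v_cont n : continuous (v_ n).
Proof. by elim: n => [|n ih] /=; [exact: cst_continuous|exact: T_cont]. Qed.

Let v_le n m x : v_ n x <= v_ (n + m)%N x.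
Proof.
elim: n x => [|n ih] x /=; first by case/andP: (v_box (0 + m) x).
by apply: T_mono.
Qed.

(** By induction: [expR L * eps = B] dominates the box, and each application of [T] multiplies the
    exponent by [k]. The sequence [w] is general because two are needed: shifted iterates, and a
    constant sequence at a fixed point. *)
Let le_v (w : nat -> X -> R) : (forall n, box (w n)) ->
  (forall n x, w n.+1 x <= T (w n) x) ->
  forall n x, w n x <= expR (k ^+ n * L) * v_ n x.
Proof.
move=> bw wT; elim=> [|n ih] x.
  rewrite expr0 mul1r /L lnK ?posrE ?divr_gt0 ?(lt_trans eps0 epsB)//.
  rewrite /v_/= divfK ?gt_eqF//.
  by case/andP: (bw 0%N x).
apply: le_trans (wT n x) _; rewrite exprS -mulrA /=.
by apply: T_contr => //; rewrite mulr_ge0// exprn_ge0//; case/andP: k01.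
Qed.

Let le_limit (a b : R) : 0 <= b ->
  (forall n, a <= expR (k ^+ n * L) * b) -> a <= b.
Proof.
move=> b0 ab.
have : (fun n => expR (k ^+ n * L) * b) @ \oo --> expR (0 * L) * b.
  apply: cvgM; last exact: cvg_cst.
  apply: (continuous_cvg _ (@continuous_expR R _)).
  apply: cvgM; last exact: cvg_cst.
  by apply: cvg_expr; rewrite ger0_norm; case/andP: k01.
rewrite mul0r expR0 mul1r => cv.
by apply: (cvgr_to_ge cv); exact: nearW.
Qed.

Let v x := sup (range (v_ ^~ x)).

Let v_has_sup x : has_sup (range (v_ ^~ x)).
Proof.
split; first by exists (v_ 0 x), 0%N.
by exists B => _ [n _ <-]; case/andP: (v_box n x).
Qed.

Let v_ub n x : v_ n x <= v x.
Proof. by apply: sup_upper_bound => //; exists n. Qed.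

Let vP x c : (forall n, v_ n x <= c) -> v x <= c.
Proof. by move=> h; apply: ge_sup => [|_ [n _ <-]//]; case: (v_has_sup x). Qed.

Let vbox : box v.
Proof.
move=> x; rewrite (le_trans _ (v_ub 0 x))//=.
apply: (vP (c := B)) => n.
by case/andP: (v_box n x).
Qed.

Let v_approx n x : v x <= expR (k ^+ n * L) * v_ n x.
Proof.
(* Shifting the iterates by [m] gives a bound uniform in [m], which passes to the supremum. *)
apply: vP => m; apply: (le_trans (v_le m n x)); rewrite addnC.
move: n x; by apply: (le_v (w := fun n => v_ (n + m))).
Qed.

(** On one side [T v <= expR (k ^ n * L) * v_ n.+1] with [v_ n.+1 <= v], and [n] tends to infinity;
    on the other [v_ n <= T (v_ n) <= T v]. *)
Let v_fixed : T v = v.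
Proof.
apply/funext => x; apply/eqP; rewrite eq_le; apply/andP; split.
  apply: le_limit => [|n].
    by case/andP: (vbox x) => /(le_trans (ltW eps0)).
  have kn0 : 0 <= k ^+ n by rewrite exprn_ge0//; case/andP: k01.
  apply: (@le_trans _ _ (expR (k * (k ^+ n * L)) * v_ n.+1 x)).
    by apply: (T_contr vbox (v_box n) (mulr_ge0 kn0 L_ge0)); exact: v_approx.
  have vn0 : 0 <= v_ n.+1 x.
    by case/andP: (v_box n.+1 x) => /(le_trans (ltW eps0)).
  rewrite ler_pM ?expR_ge0// ler_expR ler_piMl ?mulr_ge0//.
  by case/andP: k01 => _ /ltW.
apply: vP => n; apply: (le_trans (v_le n 1 x)); rewrite addn1 /=.
by apply: T_mono.
Qed.

Let v_continuous : continuous v.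
Proof.
(* The multiplicative error turns into an additive one, uniform in [x], since [v_ n <= B];
   continuity follows by splitting [e] into thirds. *)
have eE (n : nat) x : `|v x - v_ n x| <= B * (expR (k ^+ n * L) - 1).
  rewrite ger0_norm ?subr_ge0//.
  apply: (@le_trans _ _ (v_ n x * (expR (k ^+ n * L) - 1))).
    by rewrite mulrBr mulr1 lerB// mulrC.
  rewrite ler_wpM2r//; last by case/andP: (v_box n x).
  rewrite subr_ge0 -expR0 ler_expR mulr_ge0// exprn_ge0//; by case/andP: k01.
have e0 : (fun n => B * (expR (k ^+ n * L) - 1)) @ \oo --> (0 : R).
  rewrite -[X in _ --> X](mulr0 B); apply: cvgM; first exact: cvg_cst.
  rewrite -[X in _ --> X](subrr (1 : R)); apply: cvgB; last exact: cvg_cst.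
  rewrite -[X in _ --> X](@expR0 R) -[X in expR X](mul0r L).
  apply: (continuous_cvg _ (@continuous_expR R _)).
  apply: cvgM; last exact: cvg_cst.
  by apply: cvg_expr; rewrite ger0_norm; case/andP: k01.
move=> x; apply/cvgrPdist_le => e egt0.
have /cvgrPdist_le /(_ _ (divr_gt0 egt0 (ltr0Sn _ 2))) [N _ /(_ _ (leqnn N))]
  := e0.
rewrite /= sub0r normrN => /(le_trans (ler_norm _)) hN.
have /cvgrPdist_le /(_ _ (divr_gt0 egt0 (ltr0Sn _ 2))) := @v_cont N x.
apply: filterS => y vN.
have -> : v x - v y = (v x - v_ N x) + (v_ N x - v_ N y) - (v y - v_ N y).
  by ring.
apply: (le_trans (ler_normB _ _));
  apply: (le_trans (lerD (ler_normD _ _) (lexx _))).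
have := eE N x; have := eE N y; move: vN hN; lra.
Qed.

Lemma log_contraction_fixed_point :
  exists v : X -> R, [/\ forall x, eps <= v x <= B, continuous v, T v = v &
    forall w, (forall x, eps <= w x <= B) -> T w = w -> w = v].
Proof.
exists v; split => // w bw Tw; apply/funext => x; apply/eqP; rewrite eq_le.
(* The iteration starts at the least element of the box, so it stays below every fixed point. *)
have vn n y : v_ n y <= w y.
  by elim: n y => [|n ih] y /=; [case/andP: (bw y)|rewrite -Tw; exact: T_mono].
apply/andP; split; last exact: vP.
apply: le_limit => [|n]; first by case/andP: (vbox x) => /(le_trans (ltW eps0)).
apply: (@le_trans _ _ (expR (k ^+ n * L) * v_ n x));
  last by rewrite ler_pM2l ?expR_gt0.
by move: n x; apply: (le_v (w := fun=> w)) => // n x; rewrite Tw.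
Qed.

End thompson.

(** * Berge's maximum theorem *)

Lemma berge_maximum_continuous (R : realType) (X Z : topologicalType)
    (K : set (X * Z)) (f : X * Z -> R) (M : R) :
  (forall s, [set a | K (s, a)] !=set0) ->
  (forall s, compact [set a | K (s, a)]) ->
  continuous_corr (fun s => [set a | K (s, a)]) ->
  {within K, continuous f} -> (forall k, K k -> f k <= M) ->
  continuous (fun s => sup [set f (s, a) | a in [set a | K (s, a)]]).
Proof.
move=> K0 Kc [Kusc Klsc] /subspace_continuousP fc fM s0.
pose V s := [set f (s, a) | a in [set a | K (s, a)]].
have V0 s : V s !=set0 by have [a Ka] := K0 s; exists (f (s, a)), a.
have Vub s : has_ubound (V s) by exists M => _ [a Ka <-]; exact: fM.
(* An action [a0] with value above [c] has a neighbourhood where this persists; lower semicontinuity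
   of the correspondence puts feasible actions of nearby states into it. *)
have lsc c : c < sup (V s0) -> \forall s \near s0, c < sup (V s).
  move=> /(sup_gt (V0 s0)) [_ [a0 Ka0 <-] ca0].
  have : within K (nbhs (s0, a0)) [set k | c < f k].
    exact: (cvgr_gt _ (fc _ Ka0)).
  rewrite /within/= => -[[U W] /= [Us0 Wa0] UW].
  have : open [set s | [set a | K (s, a)] `&` W° !=set0].
    by apply: Klsc; exact: open_interior.
  rewrite openE => /(_ s0) oK.
  have /oK : [set s | [set a | K (s, a)] `&` W° !=set0] s0 by exists a0.
  move=> /filterI /(_ Us0); apply: filterS => s [[a [Ka Wa]] Us].
  apply: (@lt_le_trans _ _ (f (s, a))).
    by apply: (UW (s, a)) => //; split => //=; exact: interior_subset.
  by apply: ub_le_sup => //; exists a.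
have usc c : sup (V s0) < c -> \forall s \near s0, sup (V s) <= c.
  move=> cV.
  (* [P U a] asks for one neighbourhood of [a] that works for all states of [U]. Compactness of the
     section at [s0] then yields a single [U] for all its actions. *)
  pose P (U : set X) (a : Z) := exists W, [/\ open W, W a &
    forall s a', U s -> W a' -> K (s, a') -> f (s, a') < c].
  have /compact_near_coveringP/(_ _ (powerset_filter_from (nbhs s0)) P _) cov :=
    Kc s0.
  have /cov KU : forall a, K (s0, a) ->
      \forall a' \near a & U \near powerset_filter_from (nbhs s0), P U a'.
    move=> a Ka.
    have fac : f (s0, a) < c.
      by apply: le_lt_trans cV; apply: ub_le_sup => //; exists a.
    have : within K (nbhs (s0, a)) [set k | f k < c].
      exact: (cvgr_lt _ (fc _ Ka)).
    rewrite /within/= => -[[U W] /= [Us0 Wa] UW].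
    exists (W°, [set U' | U' `<=` U]).
      split => /=; first exact: nbhs_interior.
      exact: small_set_sub.
    move=> [a' U'] /= [Wa' U'U]; exists W°.
    split => //; first exact: open_interior.
    move=> s a'' /U'U Us Wa'' Kk; apply: (UW (s, a'')) => //=; split => //.
    exact: interior_subset.
  have small : \forall U \near powerset_filter_from (nbhs s0), nbhs s0 U.
    exact: near_small_set.
  have [U [Us0 {}KU]] := @filter_ex _ (powerset_filter_from (nbhs s0)) _ _
    (filterI small KU).
  (* [O] is open and contains the section at [s0]. By upper semicontinuity, applied to its closed
     complement, it contains the sections at nearby states as well. *)
  pose O := \bigcup_(W in [set W : set Z | open W /\
    forall s a, U s -> W a -> K (s, a) -> f (s, a) < c]) W.
  have cO : closed (~` O) by apply: open_closedC; apply: bigcup_open => W [].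
  have : nbhs s0 (~` [set s | [set a | K (s, a)] `&` ~` O !=set0]).
    apply: open_nbhs_nbhs; split; first exact/closed_openC/Kusc.
    by move=> [a [/KU[W [oW Wa WU]] []]]; exists W.
  move=> /filterI /(_ Us0); apply: filterS => s [KO Us].
  apply: ge_sup => // _ [a Ka <-]; apply/ltW.
  have [W [_ Wc] Wa] : O a by apply: contrapT => nOa; apply: KO; exists a.
  exact: Wc.
apply/cvgrPdist_le => e e0.
have := lsc (sup (V s0) - e); rewrite ltrBlDr ltrDl => /(_ e0).
have := usc (sup (V s0) + e); rewrite ltrDl => /(_ e0).
move=> /filterI h /h; apply: filterS => s [h1 h2].
by rewrite ler_distlC; apply/andP; split => //; exact: ltW.
Qed.

(** * Continuous functions: Borel measurability and upper semianalyticity *)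

Lemma continuous_expR_scale (R : realType) (X : topologicalType) (r : R)
    (v : X -> R) : continuous v -> continuous (fun x => expR (r * v x)).
Proof.
move=> cv x; apply: (@continuous_comp _ _ _ (fun y => r * v y) (@expR R)).
  by apply: cvgM; [exact: cvg_cst|exact: cv].
exact: continuous_expR.
Qed.

Lemma continuous_measurable_borel (R : realType) (S : borelSpace R)
    (f : S -> R) : continuous f -> measurable_fun [set: borelType S] f.
Proof.
move=> /continuousP cf.
apply: (measurability _ (RGenOpens.measurableE R)) => _ [_ [a [b ->] <-]].
rewrite setTI; apply: sub_sigma_algebra; apply: cf; exact: interval_open.
Qed.

(** A superlevel set is the projection of the open cylinder over it, with diagonal points as
    preimages. *)
Lemma continuous_upper_semianalytic (R : realType) (S : borelSpace R)
    (f : S -> R) : continuous f -> upper_semianalytic f.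
Proof.
move=> cf c; exists [set z : S * S | c < f z.1]; last first.
  by apply/seteqP; split => [s cs|_ [[s t] /= cs <-]//]; exists (s, s).
apply: sub_sigma_algebra.
have /continuousP : continuous (f \o fst : S * S -> R).
  by move=> z; apply: continuous_comp; [exact: cvg_fst|exact: cf].
by move=> /(_ _ (@open_gt R c)).
Qed.

(** * The certainty equivalent and the Bellman operator of the model *)

Lemma certainty_equivalent_bounded (R : realType) (S A : borelSpace R)
    (q : S * A -> probability (borelType S) R) (r eps B : R) (v : S -> R)
    (k : S * A) : r < 0 -> (forall s, eps <= v s <= B) ->
  eps <= certainty_equivalent r q v k <= B.
Proof.
move=> r0 bv.
exact: (@entropic_bounded _ _ R (@completed_measure_extension _ _ _ (q k))
  (completed_setT (q k)) r eps B r0 v bv).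
Qed.

Lemma certainty_equivalent_subhomogeneous (R : realType) (S A : borelSpace R)
    (q : S * A -> probability (borelType S) R) (r eps B l : R) (v w : S -> R)
    (k : S * A) : r < 0 ->
  (forall s, eps <= v s <= B) -> (forall s, eps <= w s <= B) ->
  1 <= l -> (forall s, v s <= l * w s) ->
  certainty_equivalent r q v k <= l * certainty_equivalent r q w k.
Proof.
move=> r0 bv bw l1 vw.
exact: (@entropic_subhomogeneous _ _ R
  (@completed_measure_extension _ _ _ (q k))
  (completed_setT (q k)) r eps B r0 v w l bv bw l1 vw).
Qed.

Theorem theorem4 (R : realType) (S A : borelSpace R)
    (K : set (S * A)) (u : S * A -> R)
    (q : S * A -> probability (borelType S) R)
    (b0 b1 beta r p eps B : R)
    (K_nonempty : K !=set0)
    (K_borel : borel_set K)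
    (K_sections : forall s : S, actions K s !=set0)
    (q_transition : transition_probability K q)
    (u_measurable : measurable_fun (K : set (borelType (S * A)%type)) u)
    (b0_gt0 : 0 < b0) (b0_lt_b1 : b0 < b1)
    (u_bounds : forall k, K k -> b0 <= u k <= b1)
    (beta_bounds : 0 <= beta < 1) (r_lt0 : r < 0)
    (p_lt1 : p < 1) (p_neq0 : p != 0)
    (eps_gt0 : 0 < eps) (eps_lt_B : eps < B)
    (const_neg : p < 0 -> eps <= b0 /\ (1 - beta) `^ p^-1 * b1 <= B)
    (const_pos : 0 < p -> eps <= (1 - beta) `^ p^-1 * b0 /\ b1 <= B)
    (C1_compact : forall s : S, compact (actions K s))
    (C1_continuous : continuous_corr (actions K))
    (C2 : {within K, continuous u})
    (C3 : feller K q) :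
  exists v : S -> R,
    [/\ class_C eps B v,
        bellman_equation K u q beta r p v,
        class_A eps B v
      & forall w : S -> R, class_A eps B w ->
          bellman_equation K u q beta r p w -> w = v].
Proof.
(* After unfolding [ces], the Bellman equation is [T v = v] read pointwise. *)
pose f v k := ces beta p (u k) (certainty_equivalent r q v k).
pose T v (s : S) : R := sup [set f v (s, a) | a in actions K s].
pose box (v : S -> R) := forall s, eps <= v s <= B.
have ce_box v k : box v -> eps <= certainty_equivalent r q v k <= B.
  exact: certainty_equivalent_bounded.
have f_box v k : box v -> K k -> eps <= f v k <= B.
  move=> bv Kk.
  apply: (ces_bounded beta_bounds p_neq0 b0_gt0 eps_gt0 const_neg const_pos).
    exact: u_bounds.
  exact: ce_box.
have f_ub v s : box v -> has_ubound [set f v (s, a) | a in actions K s].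
  by move=> bv; exists B => _ [a Ka <-]; case/andP: (f_box v (s, a) bv Ka).
have T_box v : box v -> box (T v).
  move=> bv s; have [a Ka] := K_sections s; apply/andP; split.
    have /andP[fe _] := f_box v (s, a) bv Ka; apply: (le_trans fe).
    by apply: ub_le_sup; [exact: f_ub|exists a].
  apply: ge_sup; first by exists (f v (s, a)), a.
  by move=> _ [a' Ka' <-]; case/andP: (f_box v (s, a') bv Ka').
have [k [k01 kE]] := ces_log_contraction beta_bounds p_neq0 b1 B b0_gt0 eps_gt0.
have T_contr v w l : box v -> box w -> 0 <= l ->
    (forall s, v s <= expR l * w s) -> forall s, T v s <= expR (k * l) * T w s.
  move=> bv bw l0 vw s; apply: ge_sup.
    by have [a Ka] := K_sections s; exists (f v (s, a)), a.
  move=> _ [a Ka <-]; apply: (@le_trans _ _ (expR (k * l) * f w (s, a))).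
    apply: kE => //; [exact: u_bounds|exact: ce_box|exact: ce_box|].
    (* Subhomogeneity with factor [expR l], which is at least 1 since [0 <= l]. *)
    apply: (certainty_equivalent_subhomogeneous _ _ r_lt0 bv bw) => //.
    by rewrite -expR0 ler_expR.
  by rewrite ler_pM2l ?expR_gt0//; apply: ub_le_sup; [exact: f_ub|exists a].
have T_cont v : box v -> continuous v -> continuous (T v).
  move=> bv cv; apply: (berge_maximum_continuous (M := B)) => //; last first.
    by move=> k' Kk'; case/andP: (f_box v k' bv Kk').
  pose g (x : S) := expR (r * v x).
  have cg : continuous g by exact: continuous_expR_scale.
  have gB : exists M, forall s, `|g s| <= M.
    exists (expR (r * eps)) => s; rewrite ger0_norm ?expR_ge0// ler_expR.
    by rewrite ler_nM2l//; case/andP: (bv s).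
  have /subspace_continuousP ic := C3 g cg gB.
  (* The Feller property speaks of [q k'], the certainty equivalent of its completion; the two
     integrals of the Borel function [g] coincide. *)
  have gE k' : \int[@completed_measure_extension _ _ _ (q k')]_x g x =
      \int[q k']_x g x.
    apply: Rintegral_completed => [|x]; last exact: expR_ge0.
    exact: continuous_measurable_borel.
  move/subspace_continuousP: C2 => uc.
  apply/subspace_continuousP => k' Kk'; apply: cvg_ces => //.
  - by case/andP: (u_bounds _ Kk') => /(lt_le_trans b0_gt0).
  - by case/andP: (ce_box v k' bv) => /(lt_le_trans eps_gt0).
  - exact: uc.
  rewrite /certainty_equivalent; apply: cvgM; first exact: cvg_cst.
  apply: (cvg_comp (fun k'' : S * A => \int[@completed_measure_extension _ _ _
      (q k'')]_x g x) (@ln R)); last first.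
    apply: continuous_ln.
    exact: (@Rintegral_expR_gt0 _ _ R
      (@completed_measure_extension _ _ _ (q k'))
      (completed_setT (q k')) r eps B r_lt0 v bv).
  by have := ic k' Kk'; rewrite /from_subspace -(funext gE) -gE.
have [v [bv cv Tv uv]] := log_contraction_fixed_point eps_gt0 eps_lt_B k01
  T_box T_cont T_contr.
exists v; split => //.
- by move=> s; rewrite -[LHS](congr1 (@^~ s) Tv).
- by split => //; exact: continuous_upper_semianalytic.
- by move=> w [_ bw] Tw; apply: uv => //; apply/funext => s; rewrite [RHS]Tw.
Qed.
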